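(* For each $m \in \mathbb{Z}_{\ge 0}$, there exists a constant $N(m) \in \mathbb{Z}_{\ge 1}$ such that the following holds: given any finite family $\mathcal{F} = \{S_1,\ldots,S_n\}$ of affine semigroups in $\mathbb{Z}^m$, and letting $C_i = \operatorname{Cone}(S_i)$ for each $i$, if the intersection of any $N(m)$ affine semigroups in $\mathcal{F}$ is nontrivial, then $S_1 \cap \cdots \cap S_n$ is nontrivial. More specifically, (a) if each $S_i$ is pointed and $C_1,\ldots,C_n$ do not cover $\mathbb{R}^m$, then $N(m) = m$; (b) if each $S_i$ is pointed and $C_1,\ldots,C_n$ cover $\mathbb{R}^m$, then $N(m) = m+1$; and (c) if some $S_i$ is not pointed, then $N(m) = 2m$.
   Context: An affine semigroup in $\mathbb{Z}^m$ is a set of the form $\operatorname{Sg}(A) = \{Ax : x \in \mathbb{Z}^p,\ x \ge 0\}$ for some integer matrix $A \in \mathbb{Z}^{m\times p}$, i.e. the set of all non-negative integer combinations of the columns of $A$. The associated cone of $S = \operatorname{Sg}(A)$ is $\operatorname{Cone}(S) = \operatorname{Cone}(A) = \{Ax : x \in \mathbb{R}^p,\ x \ge 0\} \subseteq \mathbb{R}^m$, the set of all non-negative real combinations of the columns of $A$. A semigroup $S$ is trivial if $S = \{0\}$, and nontrivial otherwise. An affine semigroup $S$ is pointed if it has no nontrivial subgroups; equivalently, $\operatorname{Cone}(S)$ contains no positive-dimensional linear subspace. The cones $C_1,\ldots,C_n$ cover $\mathbb{R}^m$ if $C_1 \cup \cdots \cup C_n = \mathbb{R}^m$. *)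

(* Defs.v *)
From HB Require Import structures.
From mathcomp Require Import all_boot all_order all_algebra.
From mathcomp Require Import boolp classical_sets reals.

Set Implicit Arguments.
Unset Strict Implicit.
Unset Printing Implicit Defensive.

Import Order.TTheory GRing.Theory Num.Theory.

Local Open Scope classical_set_scope.
Local Open Scope ring_scope.

Definition nonneg (K : numDomainType) (p : nat) : set 'cV[K]_p :=
  [set x | forall j, 0 <= x j 0].

(* The case p = 0 is allowed and gives the trivial semigroup. *)
Definition Sg (m p : nat) (A : 'M[int]_(m, p)) : set 'cV[int]_m :=
  [set A *m x | x in @nonneg int p].

Definition Cone (R : realType) (m p : nat) (A : 'M[int]_(m, p)) :
    set 'cV[R]_m :=
  [set map_mx intr A *m x | x in @nonneg R p].
Arguments Cone R {m p} A.

Definition nontrivial (V : zmodType) (S : set V) : Prop := S <> [set 0].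

Definition pointed (V : zmodType) (S : set V) : Prop :=
  forall H : {pred V},
    zmod_closed H -> [set` H] `<=` S -> ~ nontrivial [set` H].

(* As in Helly's theorem, a family with fewer than N members has no N distinct
   members to test, so the hypothesis ranges over the subfamilies with at most
   N members; when N <= n this is equivalent to testing those with exactly N.
   The intersection of the empty subfamily is the whole group V. *)
Definition helly (V : zmodType) (N n : nat) (S : 'I_n -> set V) : Prop :=
  (forall I : {set 'I_n}, (#|I| <= N)%N ->
     nontrivial (\bigcap_(i in [set` I]) S i)) ->
  nontrivial (\bigcap_i S i).

Definition covers (T : Type) (n : nat) (C : 'I_n -> set T) : Prop :=
  \bigcup_i C i = [set: T].

(* Main.v *)
Require Import Defs.
From HB Require Import structures.
From mathcomp Require Import all_boot all_order all_algebra.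
From mathcomp Require Import boolp classical_sets reals.
From mathcomp Require Import zify lra.

Set Implicit Arguments.
Unset Strict Implicit.
Unset Printing Implicit Defensive.

Import Order.TTheory GRing.Theory Num.Theory.

Local Open Scope classical_set_scope.
Local Open Scope ring_scope.

(** Why the theorem holds.  The argument is Radon's proof of Helly's theorem,
    carried out with positive linear relations.  Suppose that some
    subfamily [T_0, ..., T_(k-1)] of the semigroups meets only in [0], while
    dropping any [T_j] leaves a common nonzero point [x_j].  By induction on
    the size of subfamilies, the Helly property with number [N] follows as soon
    as every such critical subfamily has [k <= N] ([helly_of_bound]).

    Take the [x_j] as the rows of a matrix [X].  Since [x_j] lies in every [T_i]
    with [i != j], a relation [\sum_j l_j x_j = 0] gives a Radon point
    [\sum_(l_j > 0) l_j x_j = \sum_(l_j < 0) (- l_j) x_j], which lies in every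
    [T_i]: the first expression avoids [x_i] if [l_i <= 0], the second if
    [l_i >= 0].  So the Radon point is [0], that is, the space of relations is
    closed under taking positive parts ([radon], [radon_rat]).  The three bounds
    on [k] are linear algebra over the rationals:

    - In general ([nonzero_rows_bound]), closure under positive parts makes the
      space of relations a vector sublattice, spanned by nonnegative relations with
      disjoint supports, which appear as the fundamental circuits of a basis.  No [x_j] is zero, so each support has at least two
      elements, and there are [k - rank X] of them; hence [k <= 2 * rank X].

    - If all [T_i] are pointed, a nonnegative relation with a zero coefficient
      [l_i] vanishes, since it takes place inside the pointed semigroup [T_i].
      Applied to positive and negative parts, this shows that no nonzero
      relation has a zero coefficient, so the space of relations is at most a
      line: [k <= rank X + 1] ([no_partial_bound]).

    - If moreover [k = m + 1], then [X] has rank [m] and the relations are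
      spanned by a strictly positive one.  Subtracting a multiple of it from a
      linear combination of the rows makes the coefficients nonnegative and one
      of them zero, so every real vector lies in one of the cones
      ([positive_relation_covers]).  If the cones do not cover, then [k <= m]. *)

(** * Positive parts of linear relations *)

Definition pospart (K : realDomainType) k (l : 'rV[K]_k) : 'rV[K]_k :=
  map_mx (Num.max 0) l.

Lemma pospart_ge0 (K : realDomainType) k (l : 'rV[K]_k) j : 0 <= pospart l 0 j.
Proof. by rewrite mxE le_max lexx. Qed.

Lemma pospart_le0 (K : realDomainType) k (l : 'rV[K]_k) j :
  l 0 j <= 0 -> pospart l 0 j = 0.
Proof. by move=> lj; rewrite mxE; apply/max_idPl. Qed.

Lemma pospart_id (K : realDomainType) k (l : 'rV[K]_k) j :
  0 <= l 0 j -> pospart l 0 j = l 0 j.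
Proof. by move=> lj; rewrite mxE; apply/max_idPr. Qed.

Lemma pospart_decomp (K : realDomainType) k (l : 'rV[K]_k) :
  l = pospart l - pospart (- l).
Proof.
apply/rowP=> j; rewrite !mxE.
by have [] := lerP 0 (l 0 j); have [] := lerP 0 (- l 0 j); lra.
Qed.

(** For [X] of this kind the left kernel is a vector sublattice of [K^k]. *)
Definition pospart_closed (K : realFieldType) k m (X : 'M[K]_(k, m)) :=
  forall l : 'rV_k, l *m X = 0 -> pospart l *m X = 0.

Definition no_partial_relation (K : realFieldType) k m (X : 'M[K]_(k, m)) :=
  forall (l : 'rV_k) j, (forall i, 0 <= l 0 i) -> l *m X = 0 -> l 0 j = 0 ->
    l = 0.

(** * Bounds on the number of rows *)

Lemma nonzero_relation (K : fieldType) k m (X : 'M[K]_(k, m)) :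
  (\rank X < k)%N -> exists2 l : 'rV_k, l != 0 & l *m X = 0.
Proof.
move=> rX; have : kermx X != 0.
  by rewrite kermx_eq0 /row_free; apply/eqP=> rE; rewrite rE ltnn in rX.
by case/rowV0Pn=> l /sub_kermxP lX l0; exists l.
Qed.

(** Requiring the coefficient of [j] to vanish amounts to adding one column to
    [X], which raises the rank by at most one. *)
Lemma relation_with_zero (K : fieldType) k m (X : 'M[K]_(k, m)) j :
  ((\rank X).+1 < k)%N -> exists l : 'rV_k, [/\ l != 0, l *m X = 0 & l 0 j = 0].
Proof.
move=> rX.
have /nonzero_relation[l l0] :
    (\rank (row_mx X (delta_mx j (ord0 : 'I_1))) < k)%N.
  rewrite -mxrank_tr tr_row_mx -addsmxE.
  apply: leq_ltn_trans (mxrank_adds_leqif _ _) _.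
  rewrite !mxrank_tr; apply: leq_ltn_trans rX.
  by rewrite -[X in (_ <= X)%N]addn1 leq_add2l rank_leq_col.
rewrite mul_mx_row => /eqP; rewrite row_mx_eq0 => /andP[/eqP lX /eqP lj].
exists l; split=> //; move/matrixP: lj => /(_ 0 0).
by rewrite -colE !mxE.
Qed.

(** With two rows more than the rank, some nonzero relation has a zero
    coefficient; its positive and negative parts are then nonnegative relations
    with that same zero, hence both vanish. *)
Lemma no_partial_bound (K : realFieldType) k m (X : 'M[K]_(k, m)) :
  pospart_closed X -> no_partial_relation X -> (k <= (\rank X).+1)%N.
Proof.
move=> Xpos Xpt; case: leqP => // rX; have k0 : (0 < k)%N by lia.
pose j := Ordinal k0.
have [l [/eqP lN lX lj]] := relation_with_zero j rX; case: lN.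
have p0 (u : 'rV_k) : u *m X = 0 -> u 0 j = 0 -> pospart u = 0.
  move=> uX uj; apply: (Xpt _ j); [exact: pospart_ge0 | exact: Xpos |].
  by rewrite pospart_le0 // uj.
rewrite (pospart_decomp l) (p0 l) // (p0 (- l)) ?subrr //.
  by rewrite mulNmx lX oppr0.
by rewrite mxE lj oppr0.
Qed.

(** One of the two parts of a nonzero relation is nonzero, and it cannot have
    a zero coefficient. *)
Lemma positive_relation (K : realFieldType) k m (X : 'M[K]_(k, m)) :
  pospart_closed X -> no_partial_relation X -> (\rank X < k)%N ->
  exists2 l : 'rV_k, (forall j, 0 < l 0 j) & l *m X = 0.
Proof.
move=> Xpos Xpt /nonzero_relation[l lN lX].
have pos_of (u : 'rV_k) : u != 0 -> u *m X = 0 -> (forall j, 0 <= u 0 j) ->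
    exists2 l : 'rV_k, (forall j, 0 < l 0 j) & l *m X = 0.
  move=> uN uX u_ge0; exists u => // j; rewrite lt_def u_ge0 andbT.
  by apply: contraNneq uN => uj; rewrite (Xpt u j).
have [p0|pN] := eqVneq (pospart l) 0; last first.
  by apply: pos_of pN _ _; [exact: Xpos | exact: pospart_ge0].
apply: (pos_of (pospart (- l))); last exact: pospart_ge0.
  by apply: contraNneq lN => n0; rewrite (pospart_decomp l) p0 n0 subrr.
by apply: Xpos; rewrite mulNmx lX oppr0.
Qed.

(** A maximal independent set [J] of rows, described only through relations:
    independence of [J], and the fundamental circuit of each row [e] outside
    [J], that is, the relation expressing row [e] by the rows in [J]. *)
Lemma row_basis (K : fieldType) k m (X : 'M[K]_(k, m)) :
  exists J : {set 'I_k}, [/\ #|J| = \rank X,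
    forall l : 'rV_k, l *m X = 0 -> (forall j, j \notin J -> l 0 j = 0) -> l = 0
  & forall e, e \notin J -> exists l : 'rV_k, [/\ l *m X = 0, l 0 e = 1 &
      forall j, j \notin J -> j != e -> l 0 j = 0]].
Proof.
set f := maxrankfun X; have f_inj : injective f by exact: maxrankfun_inj.
have BE (a : 'rV_(\rank X)) : a *m rowsub f 1%:M *m X = a *m rowsub f X.
  by rewrite -mulmxA mul_rowsub_mx mul1mx.
have aN (a : 'rV_(\rank X)) j :
    j \notin (f @: 'I_(\rank X))%SET -> (a *m rowsub f 1%:M) 0 j = 0.
  move=> jJ; rewrite mxE big1 // => i _; rewrite !mxE.
  by case: eqP jJ => [<-|_ _]; rewrite ?mulr0 // imset_f // inE.
exists (f @: 'I_(\rank X))%SET; split.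
- by rewrite card_imset // card_ord.
- move=> l lX lJ; pose a := \row_i l 0 (f i).
  have lE : l = a *m rowsub f 1%:M.
    apply/rowP=> j.
    have [/imsetP[i _ ->]|jJ] := boolP (j \in (f @: 'I_(\rank X))%SET).
      rewrite mxE (bigD1 i) //= !mxE eqxx mulr1 big1 ?addr0 // => i' i'N.
      by rewrite !mxE (inj_eq f_inj) (negPf i'N) mulr0.
    by rewrite lJ // aN.
  have /row_freeP[Y BY] := maxrowsub_free X.
  move: lX; rewrite lE BE => aB; rewrite -[a]mulmx1 -BY mulmxA aB.
  by rewrite !mul0mx.
- move=> e eJ; have /submxP[a aE] : (row e X <= rowsub f X)%MS.
    by rewrite eq_maxrowsub row_sub.
  exists (delta_mx 0 e - a *m rowsub f 1%:M); split.
  + by rewrite mulmxBl BE -rowE aE subrr.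
  + by rewrite mxE [X in _ + X]mxE aN // mxE !eqxx subr0.
  + by move=> j jJ je; rewrite mxE [X in _ + X]mxE aN // mxE (negPf je) andbF subr0.
Qed.

(** The fundamental circuits of the rows outside a basis [J] are nonnegative,
    and their supports meet [J] in nonempty, pairwise disjoint sets.  Hence there
    are at most [#|J|] rows outside [J]. *)
Lemma nonzero_rows_bound (K : realFieldType) k m (X : 'M[K]_(k, m)) :
  pospart_closed X -> (forall j, row j X != 0) -> (k <= 2 * \rank X)%N.
Proof.
move=> Xpos XN; have [J [cJ Jfree Jcirc]] := row_basis X.
have circ e : e \notin J -> exists l : 'rV_k, [/\ l *m X = 0, l 0 e = 1,
    forall j, j \notin J -> j != e -> l 0 j = 0 & forall j, 0 <= l 0 j].
  (* A circuit equals its positive part, since their difference is a relation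
     supported in [J]. *)
  move=> eJ; have [l [lX le lJ]] := Jcirc e eJ; exists l; split=> // j.
  suff -> : l = pospart l by exact: pospart_ge0.
  apply/eqP; rewrite -subr_eq0; apply/eqP/Jfree.
    by rewrite mulmxBl lX (Xpos l lX) subrr.
  move=> i iJ; rewrite mxE [X in _ + X]mxE pospart_id ?subrr //.
  by have [->|/(lJ i iJ)->] := eqVneq i e; rewrite ?le.
(* [P e (l, j)]: [l] is the circuit of [e], and [j] is an element of [J] in its
   support. *)
pose P e (lj : 'rV[K]_k * 'I_k) := e \notin J ->
  [/\ lj.1 *m X = 0, lj.1 0 e = 1,
      forall j, j \notin J -> j != e -> lj.1 0 j = 0
    & lj.2 \in J /\ 0 < lj.1 0 lj.2].
have {circ} /choice[lg lgP] : forall e, exists lj, P e lj.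
  move=> e; have [eJ|/circ[l [lX le lJ lge]]] := boolP (e \in J).
    by exists (0, e); rewrite /P eJ.
  suff [j jJ lj] : exists2 j, j \in J & l 0 j != 0.
    by exists (l, j) => _; split=> //; split=> //=; rewrite lt_def lj lge.
  apply: contrapT => noj; have /negP[] := XN e; rewrite rowE.
  suff <- : l = delta_mx 0 e by rewrite lX.
  apply/rowP=> j; rewrite mxE /=; have [->//|je] := eqVneq j e.
  have [jJ|jJ] := boolP (j \in J); last exact: lJ.
  by apply: contra_notP noj => /eqP lj; exists j.
(* If the circuits [l] of [e] and [u] of [f] share [j] in [J], then the
   combination [d] of them that cancels [j] is positive at [e] and negative at
   [f]. Its positive part is a relation that agrees with a multiple of [l]
   outside [J], hence equals it, although it vanishes at [j]. *)
have g_inj : {in ~: J &, injective (fun e => (lg e).2)}.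
  move=> e f; rewrite !inE => eJ fJ /= gE; apply/eqP; apply: contraT => ef.
  have [lX le lJ [gJ lg0]] := lgP e eJ; have [uX uf uJ [_ ug0]] := lgP f fJ.
  move: lX le lJ gJ lg0 uX uf uJ ug0; rewrite -gE.
  set l := (lg e).1; set u := (lg f).1; set j := (lg e).2.
  move=> lX le lJ gJ lj uX uf uJ uj.
  pose d := u 0 j *: l - l 0 j *: u.
  have dE i : d 0 i = u 0 j * l 0 i - l 0 j * u 0 i by rewrite !mxE.
  have : pospart d - u 0 j *: l = 0.
    apply: Jfree.
      rewrite mulmxBl -scalemxAl lX Xpos ?scaler0 ?subrr //.
      by rewrite mulmxBl -!scalemxAl lX uX !scaler0 subrr.
    move=> i iJ; rewrite mxE [X in _ + X]mxE [X in _ - X]mxE.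
    have [->|ie] := eqVneq i e.
      by rewrite pospart_id dE (uJ e) // mulr0 subr0 ?subrr // le mulr1 ltW.
    rewrite (lJ i) // mulr0 subr0 pospart_le0 // dE (lJ i) // mulr0 sub0r oppr_le0.
    by have [->|jf] := eqVneq i f; rewrite ?uf ?mulr1 ?(uJ i) ?mulr0 // ltW.
  move/rowP=> /(_ j); rewrite mxE [X in _ + X]mxE [X in _ - X]mxE.
  rewrite pospart_le0 ?dE 1?mulrC ?subrr // mxE => /eqP.
  by rewrite sub0r oppr_eq0 mulf_eq0 !gt_eqF.
have : (#|~: J| <= #|J|)%N.
  rewrite -(card_in_imset g_inj).
  apply/subset_leq_card/fintype.subsetP=> j /imsetP[e].
  by rewrite inE => eJ ->; have [_ _ _ []] := lgP e eJ.
by have := cardsC J; rewrite card_ord cJ; lia.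
Qed.

(** * Cones over an ordered domain *)

Definition convex_cone (K : numDomainType) m (T : set 'cV[K]_m) :=
  [/\ T 0, forall x y, T x -> T y -> T (x + y)
    & forall (a : K) x, 0 <= a -> T x -> T (a *: x)].

Lemma nonneg_image_cone (K : numDomainType) m p (A : 'M[K]_(m, p)) :
  convex_cone [set A *m x | x in @nonneg K p].
Proof.
split=> [|_ _ [x x0 <-] [y y0 <-]|a _ a0 [x x0 <-]].
- by exists 0; rewrite ?mulmx0 // => j; rewrite mxE.
- by exists (x + y); rewrite ?mulmxDr // => j; rewrite mxE addr_ge0.
- by exists (a *: x); rewrite ?scalemxAr // => j; rewrite mxE mulr_ge0.
Qed.

Lemma cone_combination (K : numDomainType) m k (T : set 'cV[K]_m)
    (X : 'M[K]_(k, m)) (l : 'rV_k) :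
  convex_cone T -> (forall j, 0 <= l 0 j) ->
  (forall j, l 0 j != 0 -> T (row j X)^T) -> T (l *m X)^T.
Proof.
move=> [T0 TD TZ] l0 lT; rewrite mulmx_sum_row linear_sum /=.
elim/big_ind: _ => // j _; rewrite linearZ /=.
have [->|lj] := eqVneq (l 0 j) 0; first by rewrite scale0r.
by apply: TZ => //; exact: lT.
Qed.

(** Otherwise the integer multiples of [x] would be a nontrivial subgroup of
    [T]. *)
Lemma pointed_opp (m : nat) (T : set 'cV[int]_m) x :
  convex_cone T -> pointed T -> T x -> T (- x) -> x = 0.
Proof.
move=> [T0 TD TZ] Tpt Tx TNx; apply: contrapT => x0.
pose H : {pred 'cV[int]_m} := fun y => `[< exists z : int, y = z *: x >].
have HP y : reflect (exists z : int, y = z *: x) (y \in H) by exact: asboolP.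
apply: (Tpt H).
- split=> [|_ _ /HP[y ->] /HP[z ->]]; apply/HP; first by exists 0; rewrite scale0r.
  by exists (y - z); rewrite scalerBl.
- move=> _ /= /HP[z ->]; have [z0|z0] := lerP 0 z; first exact: TZ.
  by rewrite -[z]opprK scaleNr -scalerN; apply: TZ => //; rewrite oppr_ge0 ltW.
- move/seteqP=> [+ _] => /(_ x); apply: contra_not x0 => /=; apply.
  by apply/HP; exists 1; rewrite scale1r.
Qed.

(** * Radon points *)

Definition omit_witnesses m k (T : 'I_k -> set 'cV[int]_m) (X : 'M[int]_(k, m)) :=
  forall i j, i != j -> T i (row j X)^T.

Lemma map_intr_inj k m :
  injective (map_mx (intr : int -> rat) : 'M_(k, m) -> 'M_(k, m)).
Proof.
by move=> X Y /matrixP XY; apply/matrixP=> i j; have /[!mxE]/intr_inj := XY i j.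
Qed.

Lemma clear_denominators k (l : 'rV[rat]_k) :
  exists (d : rat) (u : 'rV[int]_k), 0 < d /\ d *: l = map_mx intr u.
Proof.
exists (\prod_j denq (l 0 j))%:~R.
exists (\row_j (numq (l 0 j) * \prod_(i | i != j) denq (l 0 i))); split.
  by rewrite ltr0z; apply: prodr_gt0 => j _; exact: denq_gt0.
apply/rowP=> j; rewrite !mxE (bigD1 j) //= !rmorphM /= mulrAC; congr (_ * _).
by rewrite mulrC -numqE.
Qed.

(** The Radon point [pospart u *m X = pospart (- u) *m X] avoids row [i] in one
    of its two expressions, so it belongs to [T i] for every [i]. *)
Lemma radon m k (T : 'I_k -> set 'cV[int]_m) (X : 'M[int]_(k, m)) :
  (forall i, convex_cone (T i)) -> omit_witnesses T X ->
  \bigcap_i T i `<=` [set 0] ->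
  forall u : 'rV_k, u *m X = 0 -> pospart u *m X = 0.
Proof.
move=> Tc XT T0 u uX.
have uE : pospart u *m X = pospart (- u) *m X.
  by apply/eqP; rewrite -subr_eq0 -mulmxBl -pospart_decomp uX.
apply: trmx_inj; rewrite trmx0; apply: T0 => i _.
wlog ui : u uX uE / u 0 i <= 0.
  move=> IH; have [ui|/ltW ui] := lerP (u 0 i) 0; first exact: (IH u).
  rewrite uE; apply: IH; rewrite ?opprK ?mulNmx ?uX ?oppr0 //.
  by rewrite mxE oppr_le0.
apply: cone_combination => // [j|j uj]; first exact: pospart_ge0.
by apply: XT; apply: contraNneq uj => <-; rewrite pospart_le0.
Qed.

(** Clearing denominators commutes with taking positive parts, because a common
    denominator is positive. *)
Lemma radon_rat m k (T : 'I_k -> set 'cV[int]_m) (X : 'M[int]_(k, m)) :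
  (forall i, convex_cone (T i)) -> omit_witnesses T X ->
  \bigcap_i T i `<=` [set 0] ->
  pospart_closed (map_mx (intr : int -> rat) X).
Proof.
move=> Tc XT T0 l lX; have [d [u [d0 du]]] := clear_denominators l.
have uX : u *m X = 0.
  apply: map_intr_inj.
  by rewrite map_mxM map_mx0 /= -du -scalemxAl lX scaler0.
have pE : d *: pospart l = map_mx intr (pospart u).
  apply/rowP=> j; move/rowP: du => /(_ j); rewrite !mxE => luj.
  by rewrite maxr_pMr ?ltW // mulr0 luj !maxElt ltr0z; case: ifP.
apply: (scalerI (lt0r_neq0 d0)).
by rewrite scalemxAl pE -map_mxM (radon Tc XT T0 uX) map_mx0 scaler0.
Qed.

(** A nonnegative relation that avoids row [j] takes place in the pointed
    semigroup [T j].  If row [i] occurred in it with a positive coefficient, the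
    relation would exhibit the opposite of row [i] as an element of [T j]. *)
Lemma pointed_no_partial_relation m k (T : 'I_k -> set 'cV[int]_m)
    (X : 'M[int]_(k, m)) :
  (forall i, convex_cone (T i)) -> (forall i, pointed (T i)) ->
  omit_witnesses T X -> (forall j, row j X != 0) ->
  no_partial_relation (map_mx (intr : int -> rat) X).
Proof.
move=> Tc Tpt XT XN l j l0 lX lj.
(* Coefficients in the semigroups must be integers. *)
have [d [u [d0 /rowP du]]] := clear_denominators l.
have {}du i : d * l 0 i = (u 0 i)%:~R by have := du i; rewrite !mxE.
have uX : u *m X = 0.
  apply: map_intr_inj.
  rewrite map_mxM map_mx0 /=; have -> : map_mx intr u = d *: l.
    by apply/rowP=> i; rewrite !mxE du.
  by rewrite -scalemxAl lX scaler0.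
have u0 i : 0 <= u 0 i by rewrite -(ler0z rat) -du mulr_ge0 // ltW.
have uj : u 0 j = 0 by apply/eqP; rewrite -(intr_eq0 rat) -du lj mulr0.
apply/rowP=> i; rewrite mxE; apply/eqP; have : d * l 0 i == 0; last first.
  by rewrite mulf_eq0 (gt_eqF d0).
rewrite du intr_eq0; apply: contraT => ui.
have ij : j != i by apply: contraNneq ui => <-; rewrite uj.
have /negP[] := XN i; apply/eqP/trmx_inj; rewrite trmx0.
apply: (pointed_opp (Tc j) (Tpt j)); first exact: XT.
have -> : - (row i X)^T = ((u - delta_mx 0 i) *m X)^T.
  by rewrite mulmxBl uX sub0r -rowE linearN.
apply: cone_combination => // i'.
  rewrite !mxE /=; have [->|_] := eqVneq i' i; last by rewrite subr0.
  by rewrite subr_ge0 -gtz0_ge1 lt_def ui u0.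
move=> i'N; apply: XT; apply: contraNneq i'N => <-.
by rewrite !mxE uj (negPf ij) andbF subr0.
Qed.

(** Given [v = c *m Y], subtract from [c] the largest (possibly negative) multiple
    of [l] that leaves it nonnegative: the coefficient at the index [i] minimizing [c i / l i]
    becomes zero, so [v] lies in [T i]. *)
Lemma positive_relation_covers (K : realFieldType) m k (T : 'I_k -> set 'cV[K]_m)
    (Y : 'M[K]_(k, m)) (l : 'rV_k) :
  (0 < k)%N -> (forall i, convex_cone (T i)) ->
  (forall i j, i != j -> T i (row j Y)^T) -> row_full Y ->
  (forall j, 0 < l 0 j) -> l *m Y = 0 -> covers T.
Proof.
move=> k0 Tc YT Yfull l0 lY; apply/seteqP; split=> // v _.
have [c vE] : exists c, v^T = c *m Y by apply/submxP; exact: submx_full.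
pose q j := c 0 j / l 0 j; pose i := [arg min_(j < Ordinal k0) q j]%O.
have iP j : q i <= q j by rewrite /i; case: arg_minP => // i' _; apply.
exists i => //; rewrite -[v]trmxK vE.
have -> : c *m Y = (c - q i *: l) *m Y.
  by rewrite mulmxBl -scalemxAl lY scaler0 subr0.
have cE j : (c - q i *: l) 0 j = (q j - q i) * l 0 j.
  by rewrite !mxE mulrBl divfK // gt_eqF.
apply: cone_combination => // j; rewrite cE.
  by rewrite mulr_ge0 ?subr_ge0 // ltW.
by move=> qN; apply: YT; apply: contraNneq qN => <-; rewrite subrr mul0r.
Qed.

(** * Helly numbers from critical subfamilies *)

Lemma nontrivialP (V : zmodType) (S : set V) :
  S 0 -> nontrivial S <-> exists2 x, S x & x != 0.
Proof.
move=> S0; split=> [SN|[x Sx xN] S1].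
  apply: contrapT => noS; apply: SN; apply/seteqP; split=> [x Sx|_ -> //].
  by apply: contra_notP noS => /eqP xN; exists x.
by move: Sx xN; rewrite S1 => /= ->; rewrite eqxx.
Qed.

Lemma helly_le (V : zmodType) N N' n (S : 'I_n -> set V) :
  (N <= N')%N -> helly N S -> helly N' S.
Proof.
by move=> NN' SN SN'; apply: SN => I cI; apply: SN'; exact: leq_trans NN'.
Qed.

(** Induction on the size of a subfamily [I]: if all proper subfamilies have a
    nontrivial intersection but [I] does not, then [I] is critical, and choosing
    a point for each omitted member gives the matrix [X]. *)
Lemma helly_of_bound m N n (S : 'I_n -> set 'cV[int]_m) :
  (forall i, convex_cone (S i)) ->
  (forall k (f : 'I_k -> 'I_n) (X : 'M[int]_(k, m)),
     omit_witnesses (S \o f) X -> (forall j, row j X != 0) ->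
     \bigcap_i S (f i) `<=` [set 0] -> (k <= N)%N) ->
  helly N S.
Proof.
move=> Sc bound SN.
have S0 D : (\bigcap_(i in D) S i) 0 by move=> i _; have [] := Sc i.
suff all_I k (I : {set 'I_n}) :
    #|I| = k -> nontrivial (\bigcap_(i in [set` I]) S i).
  rewrite (_ : [set: 'I_n] = [set` [set: 'I_n]%SET]); first exact: all_I.
  by apply/seteqP; split=> // i _; rewrite /= finset.in_setT.
elim: k I => [|k IH] I cI; first by apply: SN; rewrite cI.
have [kN|Nk] := leqP k.+1 N; first by apply: SN; rewrite cI.
rewrite -cI in Nk; pose f (i : 'I_#|I|) := enum_val i.
have /choice[x xP] (j : 'I_#|I|) :
    exists x, (\bigcap_(i in [set` I :\ f j]%SET) S i) x /\ x != 0.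
  have /(nontrivialP (S0 _))[x Sx xN] :
      nontrivial (\bigcap_(i in [set` I :\ f j]%SET) S i).
    by apply: IH; move: cI; rewrite (cardsD1 (f j)) enum_valP => -[].
  by exists x.
have rowE j : (row j (\matrix_(j, i) x j i 0))^T = x j.
  by apply/colP=> i; rewrite !mxE.
apply/(nontrivialP (S0 _)); apply: contrapT => noI.
have /negP[] : ~~ (#|I| <= N)%N by rewrite -ltnNge.
apply: (bound _ f (\matrix_(j, i) x j i 0)).
- move=> i j ij; rewrite rowE; have [+ _] := xP j; apply => /=.
  by rewrite !inE enum_valP (inj_eq enum_val_inj) ij.
- move=> j; have [_] := xP j; apply: contraNneq => xj.
  by rewrite -[x j]rowE xj trmx0.
- move=> y Sy; apply: contra_notP noI => /eqP yN; exists y => // i /= iI.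
  by rewrite -(enum_rankK_in iI iI); exact: Sy.
Qed.

Theorem theorem1p1 (R : realType) (m : nat) :
  (exists2 N : nat, (1 <= N)%N &
     forall (n : nat) (p : 'I_n -> nat) (A : forall i, 'M[int]_(m, p i)),
       helly N (fun i => Sg (A i)))
  /\
  (forall (n : nat) (p : 'I_n -> nat) (A : forall i, 'M[int]_(m, p i)),
     let S := fun i => Sg (A i) in
     let C := fun i => Cone R (A i) in
     [/\ (forall i, pointed (S i)) -> ~ covers C -> helly m S,
         (forall i, pointed (S i)) -> covers C -> helly m.+1 S
       & (exists i, ~ pointed (S i)) -> helly (2 * m)%N S]).
Proof.
have two_m n (p : 'I_n -> nat) (A : forall i, 'M[int]_(m, p i)) :
    helly (2 * m) (fun i => Sg (A i)).
  apply: helly_of_bound => [i|k f X XT XN X0]; first exact: nonneg_image_cone.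
  have Xpos : pospart_closed (map_mx intr X : 'M[rat]_(k, m)).
    by apply: radon_rat XT X0 => i; exact: nonneg_image_cone.
  apply: leq_trans (nonzero_rows_bound Xpos _) _.
    move=> j; rewrite -map_row; apply: contra (XN j) => /eqP.
    by rewrite -(map_mx0 intr) => /map_intr_inj ->.
  by rewrite leq_mul2l rank_leq_col orbT.
split.
  (* For [m = 0] the bound [2 * m] is not positive. *)
  exists (maxn 1 (2 * m)) => [|n p A]; first exact: leq_maxl.
  exact: helly_le (leq_maxr _ _) _.
move=> n p A S C; have Sc i : convex_cone (S i) by exact: nonneg_image_cone.
split=> [Spt Cncov|Spt _|_]; last exact: two_m.
- apply: helly_of_bound => // k f X XT XN X0.
  have Tc i : convex_cone ((S \o f) i) by exact: Sc.
  have Xpos := radon_rat Tc XT X0.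
  have Xpt := pointed_no_partial_relation Tc (fun i => Spt (f i)) XT XN.
  have krank := no_partial_bound Xpos Xpt.
  (* A critical subfamily with more than [m] members has rank [m], and its cones
     already cover. *)
  rewrite leqNgt; apply/negP=> mk; apply: Cncov.
  have rX : \rank (map_mx (intr : int -> rat) X) = m.
    by apply/eqP; rewrite eqn_leq rank_leq_col -ltnS (leq_trans mk krank).
  have [|l l0 lX] := positive_relation Xpos Xpt; first by rewrite rX.
  pose Y : 'M[R]_(k, m) := map_mx intr X.
  have YE : Y = map_mx ratr (map_mx (intr : int -> rat) X).
    by rewrite -map_mx_comp; apply: eq_map_mx => z /=; rewrite ratr_int.
  have Cc i : convex_cone (C i) by exact: nonneg_image_cone.
  have : covers (C \o f).
    apply: (positive_relation_covers (Y := Y) (l := map_mx ratr l)).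
    + by apply: leq_ltn_trans mk.
    + by move=> i; exact: Cc.
    + move=> i j ij; have [x x0 xE] := XT i j ij; exists (map_mx intr x).
        by move=> j'; rewrite mxE ler0z.
      by rewrite -map_mxM xE /Y -map_row map_trmx.
    + by rewrite YE row_full_map /row_full rX.
    + by move=> j; rewrite mxE ltr0q.
    + by rewrite YE -map_mxM lX map_mx0.
  move=> /seteqP[_ cov]; apply/seteqP; split=> // v /cov[i _ Cv].
  by exists (f i).
- apply: helly_of_bound => // k f X XT XN X0.
  have Tc i : convex_cone ((S \o f) i) by exact: Sc.
  have Xpt := pointed_no_partial_relation Tc (fun i => Spt (f i)) XT XN.
  apply: leq_trans (no_partial_bound (radon_rat Tc XT X0) Xpt) _.
  exact: rank_leq_col.
Qed.
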